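(* Let $\Gamma$ be a countable discrete group and $\nu$ a probability measure on $\Gamma$ with $\nu(e)>0$. Let $T\in\mathcal B(\ell^2(\Gamma))$ satisfy $\mathcal P_\nu(\mathcal P^o_\nu(T))=T$. Then $\mathcal P_\nu(T)=T$ and $\mathcal P^o_\nu(T)=T$. In particular, if $\nu$ is moreover symmetric and generating, then $T$ lies in the center of the group von Neumann algebra $L(\Gamma)$.
   Context: $\lambda$ and $\rho$ denote the left and right regular representations of $\Gamma$ on $\ell^2(\Gamma)$: $\lambda_g\delta_x=\delta_{gx}$, $\rho_g\delta_x=\delta_{xg^{-1}}$. Define the normal ucp maps on $\mathcal B(\ell^2(\Gamma))$: $\mathcal P_\nu(T)=\sum_g\nu(g)\rho_gT\rho_g^*$ and $\mathcal P^o_\nu(T)=\sum_g\nu(g)\lambda_g^*T\lambda_g$ (so that on multiplication operators $\mathcal P_\nu(M_f)=M_{f*\nu}$ and $\mathcal P^o_\nu(M_f)=M_{\nu*f}$, where $(f*\nu)(g)=\sum_h\nu(h)f(gh)$, $(\nu*f)(g)=\sum_h\nu(h)f(hg)$). $L(\Gamma)$ is the von Neumann algebra generated by $\{\lambda_g\}$. $\nu$ is symmetric if $\nu(g)=\nu(g^{-1})$ and generating if its support generates $\Gamma$ as a group. *)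

(* Defs.v *)
From HB Require Import structures.
From mathcomp Require Import all_boot all_order all_algebra.
From mathcomp Require Import boolp classical_sets reals constructive_ereal ereal esum.
From mathcomp Require Import complex.
Set Implicit Arguments. Unset Strict Implicit. Unset Printing Implicit Defensive.
Import Order.TTheory GRing.Theory Num.Theory.
Local Open Scope classical_set_scope.
Local Open Scope ring_scope.

Section Defs.
Variables (R : realType) (G : groupType).

Definition rsum (f : G -> R) : R :=
  fine (\esum_(x in [set: G]) (Num.max (f x) 0)%:E)
  - fine (\esum_(x in [set: G]) (Num.max (- f x) 0)%:E).

Definition cnorm (z : R[i]) : R :=
  Num.sqrt (complex.Re z ^+ 2 + complex.Im z ^+ 2).

Definition csum (f : G -> R[i]) : R[i] :=
  Complex (rsum (fun x => complex.Re (f x))) (rsum (fun x => complex.Im (f x))).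

(* Operators on l^2(G) are represented by their matrix coefficients in the *)
(* canonical basis (delta_x): T x y = < T delta_y , delta_x >.              *)
Definition op := G -> G -> R[i].

(* T is the matrix of a bounded operator on l^2(G): the sesquilinear form  *)
(* (u, v) |-> < T v , u > is bounded on finitely supported vectors.         *)
Definition bounded_op (T : op) : Prop :=
  exists C : R, forall (s : seq G), uniq s -> forall u v : G -> R[i],
    cnorm (\sum_(x <- s) \sum_(y <- s) (conjc (u x) * T x y * v y))
      <= C * Num.sqrt (\sum_(x <- s) cnorm (u x) ^+ 2)
           * Num.sqrt (\sum_(y <- s) cnorm (v y) ^+ 2).

Definition op_mul (S T : op) : op := fun x y => csum (fun z => S x z * T z y).

(* Left and right regular representations:                                 *)
(*  lambda_g delta_x = delta_{g x},  rho_g delta_x = delta_{x g^-1}.        *)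
Definition lambda (g : G) : op :=
  fun x y => if x == (g * y)%g then 1 else 0.
Definition rho (g : G) : op :=
  fun x y => if x == (y * g^-1)%g then 1 else 0.

Definition commutant (A : op -> Prop) (T : op) : Prop :=
  bounded_op T /\ forall S, A S -> op_mul S T = op_mul T S.

(* L(G) = von Neumann algebra generated by {lambda_g} = its bicommutant. *)
Definition groupvN : op -> Prop :=
  commutant (commutant (fun S => exists g, S = lambda g)).

Definition center_groupvN (T : op) : Prop :=
  groupvN T /\ forall S, groupvN S -> op_mul S T = op_mul T S.

(* P_nu(T) = sum_g nu(g) rho_g T rho_g^*, whose coefficients are            *)
(*   < rho_g T rho_g^* delta_y, delta_x > = T (x g) (y g).                  *)
Definition Pnu (nu : G -> R) (T : op) : op :=
  fun x y => csum (fun g => ((nu g)%:C)%C * T (x * g)%g (y * g)%g).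

(* P^o_nu(T) = sum_g nu(g) lambda_g^* T lambda_g, with coefficients         *)
(*   < lambda_g^* T lambda_g delta_y, delta_x > = T (g x) (g y).            *)
Definition Pnu_o (nu : G -> R) (T : op) : op :=
  fun x y => csum (fun g => ((nu g)%:C)%C * T (g * x)%g (g * y)%g).

Definition prob_measure (nu : G -> R) : Prop :=
  (forall g, 0 <= nu g) /\ \esum_(g in [set: G]) (nu g)%:E = 1%E.

Definition symmetric_measure (nu : G -> R) : Prop :=
  forall g, nu g = nu (g^-1)%g.

Definition generating_measure (nu : G -> R) : Prop :=
  forall S : set G,
    S 1%g -> (forall x y, S x -> S y -> S (x * y)%g) -> (forall x, S x -> S (x^-1)%g) ->
    (forall g, nu g != 0 -> S g) -> forall x, S x.

Definition countable_group : Prop := exists f : G -> nat, injective f.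

End Defs.

(* Main.v *)
Require Import Defs.
From HB Require Import structures.
From mathcomp Require Import all_boot all_order all_algebra.
From mathcomp Require Import boolp classical_sets reals constructive_ereal ereal esum.
From mathcomp Require Import complex.
From mathcomp Require Import functions cardinality fsbigop finmap ring lra.
Import Order.TTheory GRing.Theory Num.Theory.
Local Open Scope ring_scope.

(** Real and imaginary parts of the matrix coefficients are treated separately,
    as bounded real functions on [G * G], on which [Pnu] and [Pnu_o] are the
    averages [P] and [Q] over the diagonal right and left translations; these
    commute.

    If [P (Q f) = f], put [D j = Q^j (P f - f)].  Then [D j = P (D j.+1)], so the
    atom at the identity keeps [D j z] close to [sup (D 0)] as soon as [D 0 z]
    is, while the sum of the [D j z] telescopes and stays bounded: [P f <= f],
    and [P f >= f] by symmetry.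

    Let now [P t = Q t = t] with square-summable columns.  The function
    [w = P (t^2) - t^2] is an average of the squares of the [Q]-harmonic functions
    [t(zh,xh) - t(z,x)], hence [0 <= w <= Q w].  Summing over columns gives
    [u = P F - F] with [0 <= u <= Q u] and [F] the bounded column sums of [t^2].
    At the identity [Q^k] and [P^k] agree, so [Q^k u (1) = P^(k+1) F (1) - P^k F (1)]
    is nondecreasing in [k] with bounded sums, hence zero.  This spreads along the
    support of [nu], so [u = 0] and [t] is invariant under right translations;
    inverting the variables gives left translations.  A bi-invariant operator
    commutes with the left regular representation, and also with every
    left-invariant [S], by the change of variable [z |-> y z^-1 x] in [S T]. *)

(** * Unconditional sums *)

Section Sums.
Context {R : realType} {G : groupType}.
Implicit Types (f g : G -> R).

Definition summ f : Prop := summable [set: G] (EFin \o f).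

(** [fine] sends an infinite sum to 0, so the value is meaningful only together with [summ f]. *)
Definition nnsum f : R := fine (\esum_(x in [set: G]) (f x)%:E).

Definition pos f : G -> R := fun x => Num.max (f x) 0.
Definition neg f : G -> R := fun x => Num.max (- f x) 0.

Lemma rsumE f : rsum f = nnsum (pos f) - nnsum (neg f).
Proof. by []. Qed.

Lemma pos_ge0 f x : 0 <= pos f x.
Proof. by rewrite /pos le_max lexx orbT. Qed.

Lemma neg_ge0 f x : 0 <= neg f x.
Proof. by rewrite /neg le_max lexx orbT. Qed.

Lemma pos_le_norm f x : pos f x <= `|f x|.
Proof. by rewrite /pos ge_max ler_norm normr_ge0. Qed.

Lemma neg_le_norm f x : neg f x <= `|f x|.
Proof. by rewrite /neg ge_max -normrN ler_norm normr_ge0. Qed.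

Lemma pos_sub_neg f x : f x = pos f x - neg f x.
Proof. by rewrite /pos /neg; case: (leP (f x) 0) => h; case: leP => h'; lra. Qed.

Lemma summ_nnsum {f} : (forall x, 0 <= f x) -> summ f ->
  (\esum_(x in [set: G]) (f x)%:E)%E = (nnsum f)%:E.
Proof.
move=> f0 sf; rewrite /nnsum fineK//.
rewrite (eq_esum (b := fun x => `|(f x)%:E|%E)) -?summableE// => x _ /=.
by rewrite ger0_norm.
Qed.

Lemma summ_fin f K : (forall x, 0 <= f x) ->
  (\esum_(x in [set: G]) (f x)%:E <= K%:E)%E -> summ f.
Proof.
move=> f0 h; rewrite /summ /summable.
rewrite (eq_esum (b := fun x => (f x)%:E)) => [|x _ /=]; last by rewrite ger0_norm.
exact: le_lt_trans h (ltry _).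
Qed.

Lemma summ_le {f g} : (forall x, `|f x| <= g x) -> summ g -> summ f.
Proof.
move=> h sg; apply: le_lt_trans sg; apply: le_esum => x _ /=.
by rewrite lee_fin (le_trans (h x)) ?ler_norm.
Qed.

Lemma summ_norm {f} : summ f -> summ (fun x => `|f x|).
Proof. by move=> sf; apply: le_lt_trans sf; apply: le_esum => x _ /=; rewrite normr_id. Qed.

Lemma summN {f} : summ f -> summ (fun x => - f x).
Proof. by move/summ_norm; apply: summ_le => x; rewrite normrN. Qed.

Lemma summD {f g} : summ f -> summ g -> summ (fun x => f x + g x).
Proof. exact: summableD. Qed.

Lemma summB {f g} : summ f -> summ g -> summ (fun x => f x - g x).
Proof. by move=> sf /summN; exact: summD. Qed.

Lemma summ_pos {f} : summ f -> summ (pos f).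
Proof. by move/summ_norm; apply: summ_le => x; rewrite ger0_norm ?pos_ge0 ?pos_le_norm. Qed.

Lemma summ_neg {f} : summ f -> summ (neg f).
Proof. by move/summ_norm; apply: summ_le => x; rewrite ger0_norm ?neg_ge0 ?neg_le_norm. Qed.

Lemma nnsum_ge0 f : (forall x, 0 <= f x) -> 0 <= nnsum f.
Proof. by move=> f0; apply: fine_ge0; apply: esum_ge0 => x _; rewrite lee_fin. Qed.

Lemma nnsumD f g : (forall x, 0 <= f x) -> (forall x, 0 <= g x) -> summ f -> summ g ->
  nnsum (fun x => f x + g x) = nnsum f + nnsum g.
Proof.
move=> f0 g0 sf sg; apply: EFin_inj; rewrite EFinD -!summ_nnsum ?summD//.
- by rewrite -esumD// => x _; rewrite lee_fin.
- by move=> x; rewrite addr_ge0.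
- exact: summD.
Qed.

(** Any splitting into nonnegative summable parts computes [rsum]: with [h = f - g], the identity
    [pos h + g = neg h + f] involves only nonnegative terms, where sums are additive. *)
Lemma rsum_sub f g : (forall x, 0 <= f x) -> (forall x, 0 <= g x) -> summ f -> summ g ->
  rsum (fun x => f x - g x) = nnsum f - nnsum g.
Proof.
move=> f0 g0 sf sg; have sfg := summB sf sg.
set h := fun x => f x - g x in sfg *.
have : nnsum (fun x => pos h x + g x) = nnsum (fun x => neg h x + f x).
  congr nnsum; apply/funext => x; have := pos_sub_neg h x; rewrite /h; lra.
rewrite !nnsumD ?rsumE//; do ?[exact: pos_ge0 | exact: neg_ge0 | exact: summ_pos | exact: summ_neg].
by lra.
Qed.

Lemma rsum_nn f : (forall x, 0 <= f x) -> rsum f = nnsum f.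
Proof.
move=> f0; have -> : rsum f = rsum (fun x => f x - 0).
  by congr rsum; apply/funext => x; rewrite subr0.
have n0 : nnsum (fun=> 0) = 0 by rewrite /nnsum esum1.
have pf : pos (fun x => f x - 0) = f.
  by apply/funext => x; rewrite /pos subr0; case: leP (f0 x) => // ? ?; apply/le_anti/andP.
have nf : neg (fun x => f x - 0) = fun=> 0.
  by apply/funext => x; rewrite /neg subr0; case: leP => // h; have := f0 x; lra.
by rewrite rsumE pf nf n0 subr0.
Qed.

Lemma rsumD f g : summ f -> summ g -> rsum (fun x => f x + g x) = rsum f + rsum g.
Proof.
move=> sf sg.
have [[p1 p2] [n1 n2]] := ((summ_pos sf, summ_pos sg), (summ_neg sf, summ_neg sg)).
rewrite (_ : (fun x => f x + g x) = fun x => (pos f x + pos g x) - (neg f x + neg g x)).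
  rewrite (rsum_sub _ _ _ _ (summD p1 p2) (summD n1 n2)).
  - rewrite !nnsumD// ?rsumE; do ?[exact: pos_ge0|exact: neg_ge0].
    by ring.
  - by move=> x; rewrite addr_ge0 ?pos_ge0.
  - by move=> x; rewrite addr_ge0 ?neg_ge0.
by apply/funext => x; rewrite {1}(pos_sub_neg f x) {1}(pos_sub_neg g x); ring.
Qed.

Lemma rsumN f : rsum (fun x => - f x) = - rsum f.
Proof.
rewrite !rsumE opprB; congr (nnsum _ - nnsum _).
by apply/funext => x; rewrite /pos /neg opprK.
Qed.

Lemma rsumB f g : summ f -> summ g -> rsum (fun x => f x - g x) = rsum f - rsum g.
Proof. by move=> sf sg; rewrite rsumD ?rsumN//; exact: summN. Qed.

Lemma rsum_ge0 f : (forall x, 0 <= f x) -> 0 <= rsum f.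
Proof. by move=> f0; rewrite rsum_nn ?nnsum_ge0. Qed.

Lemma ler_rsum f g : summ f -> summ g -> (forall x, f x <= g x) -> rsum f <= rsum g.
Proof.
by move=> sf sg fg; rewrite -subr_ge0 -rsumB ?rsum_ge0// => x; rewrite subr_ge0.
Qed.

(** An unconditional sum of nonnegative terms is the supremum of its finite partial sums; bounds on
    finite lists enter the argument this way. *)
Lemma rsum_bound f K : (forall x, 0 <= f x) ->
  (forall s : seq G, uniq s -> \sum_(x <- s) f x <= K) -> summ f /\ rsum f <= K.
Proof.
move=> f0 h.
have le : (\esum_(x in [set: G]) (f x)%:E <= K%:E)%E.
  apply: ge_ereal_sup => _ [X [finX _]] <-.
  rewrite fsbig_finite//= sumEFin lee_fin; apply: h; exact: fset_uniq.
have sf := summ_fin _ _ f0 le.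
by split => //; rewrite rsum_nn// -lee_fin -summ_nnsum.
Qed.

Lemma rsum_ge_sum f (s : seq G) : (forall x, 0 <= f x) -> summ f -> uniq s ->
  \sum_(x <- s) f x <= rsum f.
Proof.
move=> f0 sf us; rewrite rsum_nn// -lee_fin -summ_nnsum// -sumEFin.
apply: esum_ge; exists [set` s]%classic; first by split => //; exact: finite_seq.
by rewrite fsbig_seq.
Qed.

Lemma rsum_ge_term f x : (forall x, 0 <= f x) -> summ f -> f x <= rsum f.
Proof. by move=> f0 sf; have := rsum_ge_sum f [:: x] f0 sf isT; rewrite big_seq1. Qed.

Lemma summZ c f : summ f -> summ (fun x => c * f x).
Proof.
move=> sf; apply: (@summ_le _ (fun x => `|c| * `|f x|)); first by move=> x; rewrite normrM.
apply: (proj1 (rsum_bound _ (`|c| * rsum (fun x => `|f x|)) _ _)) => [x|s us].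
  by rewrite mulr_ge0.
by rewrite -mulr_sumr ler_wpM2l// rsum_ge_sum//; exact: summ_norm.
Qed.

Lemma rsumZ_le c f : 0 <= c -> (forall x, 0 <= f x) -> summ f ->
  rsum (fun x => c * f x) <= c * rsum f.
Proof.
move=> c0 f0 sf; apply: (proj2 (rsum_bound _ _ _ _)) => [x|s us].
  by rewrite mulr_ge0.
by rewrite -mulr_sumr ler_wpM2l// rsum_ge_sum.
Qed.

Lemma rsumZ c f : summ f -> rsum (fun x => c * f x) = c * rsum f.
Proof.
have nnZ d h : 0 < d -> (forall x, 0 <= h x) -> summ h ->
    rsum (fun x => d * h x) = d * rsum h.
  move=> d0 h0 sh; apply/eqP; rewrite eq_le rsumZ_le ?(ltW d0)//=.
  (* The reverse inequality is [rsumZ_le] for the factor [d^-1] and the function [d * h]. *)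
  rewrite -(ler_pM2l (x := d^-1)) ?invr_gt0// mulKf ?gt_eqF//.
  rewrite -[X in rsum X <= _](_ : (fun x => d^-1 * (d * h x)) = h).
    by rewrite rsumZ_le ?invr_ge0 ?(ltW d0) ?summZ// => [x|]; [rewrite mulr_ge0 ?(ltW d0)|exact: summZ].
  by apply/funext => x; rewrite mulKf ?gt_eqF.
have posZ d : 0 < d -> summ f -> rsum (fun x => d * f x) = d * rsum f.
  move=> d0 sf; have [sp sn] := (summ_pos sf, summ_neg sf).
  rewrite (_ : (fun x => d * f x) = fun x => d * pos f x - d * neg f x); last first.
    by apply/funext => x; rewrite {1}(pos_sub_neg f x) mulrBr.
  rewrite rsumB; [|exact: summZ..].
  rewrite !nnZ//; [|exact: neg_ge0|exact: pos_ge0].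
  rewrite [rsum f]rsumE !rsum_nn ?mulrBr//; [exact: neg_ge0|exact: pos_ge0].
move=> sf; case: (ltgtP c 0) => [c0|/posZ|->]; last 2 first.
- exact.
- rewrite mul0r (_ : (fun x => _) = fun=> 0); last by apply/funext => x; rewrite mul0r.
  by rewrite rsum_nn// /nnsum esum1.
rewrite -[c]opprK mulNr -posZ ?oppr_gt0// -rsumN; congr rsum; apply/funext => x.
by rewrite mulNr.
Qed.

Lemma rsum_reindex (e : G -> G) f : bijective e -> rsum (fun x => f (e x)) = rsum f.
Proof.
move=> be; have sb : set_bij [set: G] [set: G] e.
  by split=> // [x y _ _|x _]; [exact: (bij_inj be)|case: be => e' _ e'K; exists (e' x)].
by rewrite /rsum [in RHS](reindex_esum _ _ _ _ sb) [X in _ = _ - fine X](reindex_esum _ _ _ _ sb).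
Qed.

Lemma summ_reindex (e : G -> G) f : bijective e -> summ f -> summ (fun x => f (e x)).
Proof.
move=> be; have sb : set_bij [set: G] [set: G] e.
  by split=> // [x y _ _|x _]; [exact: (bij_inj be)|case: be => e' _ e'K; exists (e' x)].
by rewrite /summ /summable (reindex_esum _ _ _ _ sb).
Qed.

(** Tonelli: in the extended reals both iterated sums equal the sum over [G * G], which is invariant
    under exchanging the coordinates. *)
Lemma rsum_swap_nn (a : G -> G -> R) : (forall x y, 0 <= a x y) ->
  (forall x, summ (a x)) -> summ (fun x => rsum (a x)) ->
  [/\ forall y, summ (a^~ y), summ (fun y => rsum (a^~ y)) &
  rsum (fun x => rsum (a x)) = rsum (fun y => rsum (a^~ y))].
Proof.
move=> a0 sa ssa.
have cola y : summ (a^~ y).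
  by apply: summ_le ssa => x; rewrite ger0_norm// rsum_ge_term.
have ra x : 0 <= rsum (a x) by rewrite rsum_ge0.
have ca y : 0 <= rsum (a^~ y) by rewrite rsum_ge0.
have E1 : (\esum_(x in [set: G]) (rsum (a x))%:E = 
   \esum_(x in [set: G]) \esum_(y in [set: G]) (a x y)%:E)%E.
  by apply: eq_esum => x _; rewrite rsum_nn// summ_nnsum.
have E2 : (\esum_(x in [set: G]) (rsum (a^~ x))%:E = 
   \esum_(x in [set: G]) \esum_(y in [set: G]) (a y x)%:E)%E.
  by apply: eq_esum => x _; rewrite rsum_nn// summ_nnsum.
have E : (\esum_(x in [set: G]) (rsum (a x))%:E = \esum_(x in [set: G]) (rsum (a^~ x))%:E)%E.
  rewrite E1 E2 !esum_esum//; do ?by move=> *; rewrite lee_fin.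
  have -> : ([set: G] `*`` (fun=> [set: G]) = [set: G * G])%classic by apply/seteqP.
  rewrite (reindex_esum [set: G * G] [set: G * G] (fun p => (p.2, p.1)))//.
  by split=> //= [[x y] [x' y'] _ _ [-> ->] | [x y] _] //; exists (y, x).
have sc : summ (fun y => rsum (a^~ y)).
  by apply: (summ_fin _ (rsum (fun x => rsum (a x)))) => //; rewrite -E rsum_nn// summ_nnsum.
by split=> //; apply: EFin_inj; rewrite !(rsum_nn (fun _ => rsum _))// -!summ_nnsum.
Qed.

(** Fubini, by applying Tonelli to the positive and negative parts, both dominated by the absolute
    value. *)
Lemma rsum_swap (a : G -> G -> R) :
  (forall x, summ (a x)) -> summ (fun x => rsum (fun y => `|a x y|)) ->
  rsum (fun x => rsum (a x)) = rsum (fun y => rsum (a^~ y)).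
Proof.
move=> sa ssa.
have H (b : G -> G -> R) : (forall x y, 0 <= b x y) -> (forall x y, b x y <= `|a x y|) ->
    [/\ forall x, summ (b x), summ (fun x => rsum (b x)), forall y, summ (b^~ y),
      summ (fun y => rsum (b^~ y)) & rsum (fun x => rsum (b x)) = rsum (fun y => rsum (b^~ y))].
  move=> b0 ba; have sb x : summ (b x).
    by apply: summ_le (summ_norm (sa x)) => y; rewrite ger0_norm.
  have sbb : summ (fun x => rsum (b x)).
    apply: summ_le ssa => x; rewrite ger0_norm ?rsum_ge0// ler_rsum//.
    exact/summ_norm.
  by have [? ? ?] := rsum_swap_nn b b0 sb sbb.
have [p1 p2 p3 p4 p5] := H (fun x => pos (a x)) (fun x => pos_ge0 _) (fun x => pos_le_norm _).
have [n1 n2 n3 n4 n5] := H (fun x => neg (a x)) (fun x => neg_ge0 _) (fun x => neg_le_norm _).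
have E (b : G -> G -> R) (p n : G -> G -> R) : (forall x, summ (p x)) -> (forall x, summ (n x)) ->
    summ (fun x => rsum (p x)) -> summ (fun x => rsum (n x)) ->
    (forall x y, b x y = p x y - n x y) ->
    rsum (fun x => rsum (b x)) = rsum (fun x => rsum (p x)) - rsum (fun x => rsum (n x)).
  move=> sp sn spp snn h; rewrite -rsumB//; congr rsum; apply/funext => x.
  by rewrite -rsumB//; congr rsum; apply/funext.
rewrite (E a (fun x => pos (a x)) (fun x => neg (a x)))//; last by move=> x y; exact: pos_sub_neg.
rewrite (E (fun y => a^~ y) (fun y => (fun x => pos (a x))^~ y) (fun y => (fun x => neg (a x))^~ y))//.
  by rewrite p5 n5.
by move=> x y; exact: pos_sub_neg.
Qed.

End Sums.

(** * Averages of bounded functions *)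

Definition bnd {R : realType} {X : Type} (f : X -> R) : Prop := exists M, forall x, `|f x| <= M.

Section Bounded.
Context {R : realType} {X : Type}.
Implicit Types f g : X -> R.

Lemma bndD f g : bnd f -> bnd g -> bnd (fun x => f x + g x).
Proof.
move=> [M hM] [N hN]; exists (M + N) => x.
by rewrite (le_trans (ler_normD _ _))// lerD.
Qed.

Lemma bndN f : bnd f -> bnd (fun x => - f x).
Proof. by move=> [M hM]; exists M => x; rewrite normrN. Qed.

Lemma bndB f g : bnd f -> bnd g -> bnd (fun x => f x - g x).
Proof. by move=> bf /bndN; exact: bndD. Qed.

Lemma bndM f g : bnd f -> bnd g -> bnd (fun x => f x * g x).
Proof.
move=> [M hM] [N hN]; exists (M * N) => x.
by rewrite normrM ler_pM.
Qed.

Lemma bnd_cst (c : R) : bnd (fun _ : X => c).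
Proof. by exists `|c|. Qed.

Lemma bnd_sqr f : bnd f -> bnd (fun x => f x ^+ 2).
Proof. by move=> bf; apply: bndM. Qed.

Lemma bnd_comp {Y : Type} (h : Y -> X) f : bnd f -> bnd (fun y => f (h y)).
Proof. by move=> [M hM]; exists M. Qed.

End Bounded.

(** The gap [d - D j] grows at most by the factor [al^-1] per step. Starting below
    [al ^+ n * (d / 2)], it stays below [d / 2] for [n] steps, so each of the [n] summands is at
    least [d / 2]. *)
Lemma slow_decay_sum {R : realType} (al d : R) n (D : nat -> R) : 0 < al -> al <= 1 -> 0 <= d ->
  d - D 0%N <= al ^+ n * (d / 2) -> (forall j, D j <= d) ->
  (forall j, al * (d - D j.+1) <= d - D j) -> n%:R * (d / 2) <= \sum_(j < n) D j.+1.
Proof.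
move=> al0 al1 d0 D0 Dd step.
have low j : al ^+ j * (d - D j) <= al ^+ n * (d / 2).
  elim: j => [|j IH]; first by rewrite expr0 mul1r.
  by apply: le_trans IH; rewrite exprSr -mulrA ler_wpM2l// exprn_ge0// ltW.
have low' j : (j <= n)%N -> d / 2 <= D j.
  move=> jn; have : al ^+ n * (d - D j) <= al ^+ n * (d / 2).
    apply: le_trans (low j); rewrite ler_wpM2r ?subr_ge0//.
    by apply: ler_wiXn2l => //; exact: ltW.
  by rewrite ler_pM2l ?exprn_gt0//; lra.
rewrite mulr_natl -[n in X in X <= _]card_ord -sumr_const.
by apply: ler_sum => j _; exact: low'.
Qed.

(** * Integration against [nu] *)

Section Mean.
Context {R : realType} {G : groupType} (nu : G -> R).
Hypothesis nuP : prob_measure nu.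

Definition mean (f : G -> R) : R := rsum (fun g => nu g * f g).

Let nu0 g : 0 <= nu g. Proof. by case: nuP. Qed.

Lemma summ_prob : summ nu.
Proof. by apply: (summ_fin _ 1) => //; case: nuP => _ ->. Qed.

Lemma rsum_prob : rsum nu = 1.
Proof. by rewrite rsum_nn// /nnsum; case: nuP => _ ->. Qed.

Lemma summ_mean f : bnd f -> summ (fun g => nu g * f g).
Proof.
move=> [M hM]; apply: summ_le (summZ M _ summ_prob) => g.
by rewrite normrM ger0_norm// mulrC ler_wpM2r.
Qed.

Lemma meanD f g : bnd f -> bnd g -> mean (fun x => f x + g x) = mean f + mean g.
Proof.
move=> bf bg; rewrite /mean -rsumD; [|exact: summ_mean..].
by congr rsum; apply/funext => x; rewrite mulrDr.
Qed.

Lemma meanN f : mean (fun x => - f x) = - mean f.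
Proof. by rewrite /mean -rsumN; congr rsum; apply/funext => x; rewrite mulrN. Qed.

Lemma meanB f g : bnd f -> bnd g -> mean (fun x => f x - g x) = mean f - mean g.
Proof. by move=> bf bg; rewrite meanD ?meanN//; exact: bndN. Qed.

Lemma meanZ c f : bnd f -> mean (fun x => c * f x) = c * mean f.
Proof.
move=> bf; rewrite /mean -rsumZ; last exact: summ_mean.
by congr rsum; apply/funext => x; rewrite mulrCA.
Qed.

Lemma mean_cst c : mean (fun=> c) = c.
Proof.
rewrite -[RHS]mulr1 -rsum_prob -rsumZ; last exact: summ_prob.
by congr rsum; apply/funext => x; rewrite mulrC.
Qed.

Lemma ler_mean f g : bnd f -> bnd g -> (forall x, f x <= g x) -> mean f <= mean g.
Proof.
by move=> bf bg fg; apply: ler_rsum => [||x]; [exact: summ_mean..|rewrite ler_wpM2l].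
Qed.

Lemma mean_ge0 f : (forall x, 0 <= f x) -> 0 <= mean f.
Proof. by move=> f0; apply: rsum_ge0 => x; rewrite mulr_ge0. Qed.

Lemma mean_le f M : bnd f -> (forall x, f x <= M) -> mean f <= M.
Proof. by move=> bf h; rewrite -[M]mean_cst ler_mean//; exact: bnd_cst. Qed.

Lemma mean_norm_le f M : (forall x, `|f x| <= M) -> `|mean f| <= M.
Proof.
move=> h; have bf : bnd f by exists M.
rewrite ler_norml; apply/andP; split; last by apply: mean_le => // x; exact: le_trans (ler_norm _) (h x).
rewrite lerNl -meanN; apply: mean_le => [|x]; first exact: bndN.
by apply: le_trans (h x); rewrite -normrN ler_norm.
Qed.

Lemma mean_ge_term f g : bnd f -> (forall x, 0 <= f x) -> nu g * f g <= mean f.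
Proof.
move=> bf f0; apply: (rsum_ge_term (fun g => nu g * f g)) => [x|]; first by rewrite mulr_ge0.
exact: summ_mean.
Qed.

(** Nonnegativity of the variance: expand the mean of [(f x - c) ^+ 2] with [c = mean f]. *)
Lemma mean_sqr_le f : bnd f -> mean f ^+ 2 <= mean (fun x => f x ^+ 2).
Proof.
move=> bf; set c := mean f.
have b2 := bnd_sqr _ bf; have bc : bnd (fun x => (2 * c) * f x) by apply: bndM => //; exact: bnd_cst.
have : 0 <= mean (fun x => (f x ^+ 2 - (2 * c) * f x) + c ^+ 2).
  by apply: mean_ge0 => x; rewrite (_ : _ + _ = (f x - c) ^+ 2) ?sqr_ge0//; ring.
rewrite meanD; [|exact: bndB|exact: bnd_cst].
rewrite meanB// meanZ// mean_cst.
by rewrite -/c => h; nra.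
Qed.

Lemma mean_swap (f : G -> G -> R) : bnd (fun p : G * G => f p.1 p.2) ->
  mean (fun g => mean (f g)) = mean (fun h => mean (f^~ h)).
Proof.
move=> [M hM]; have b1 g : bnd (f g) by exists M => h; exact: (hM (g, h)).
have b2 h : bnd (f^~ h) by exists M => g; exact: (hM (g, h)).
have E (k : G -> G -> R) : (forall g, bnd (k g)) ->
    mean (fun g => mean (k g)) = rsum (fun g => rsum (fun h => nu g * (nu h * k g h))).
  by move=> bk; congr rsum; apply/funext => g; rewrite -rsumZ//; exact: summ_mean.
rewrite !E// rsum_swap.
- by congr rsum; apply/funext => h; congr rsum; apply/funext => g; rewrite mulrCA.
- by move=> g; apply: summZ; exact: summ_mean.
apply: summ_le (summ_mean (fun=> M) (bnd_cst M)) => g.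
rewrite ger0_norm ?rsum_ge0//.
rewrite (_ : (fun h => _) = fun h => nu g * (nu h * `|f g h|)).
  have bn : bnd (fun h => `|f g h|) by exists M => h; rewrite normr_id; exact: (hM (g, h)).
  rewrite rsumZ; last exact: summ_mean.
  by rewrite ler_wpM2l// mean_le// => h; exact: (hM (g, h)).
by apply/funext => h; rewrite !normrM !(ger0_norm (nu0 _)).
Qed.

(** Tonelli for counting measure against [nu]; the uniform bound [K] makes the double sum finite. *)
Lemma rsum_mean (f : G -> G -> R) K : (forall h z, 0 <= f h z) ->
  (forall h, summ (f h)) -> (forall h, rsum (f h) <= K) ->
  summ (fun z => mean (f^~ z)) /\ rsum (fun z => mean (f^~ z)) = mean (fun h => rsum (f h)).
Proof.
move=> f0 sf hK.
have bs : bnd (fun h => rsum (f h)) by exists K => h; rewrite ger0_norm ?rsum_ge0.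
have [||| _ s2 E] := rsum_swap_nn (fun h z => nu h * f h z).
- by move=> h z; rewrite mulr_ge0.
- by move=> h; exact: summZ.
- under eq_fun do rewrite rsumZ//.
  exact: summ_mean.
split; first exact: s2.
by rewrite /mean -E; congr rsum; apply/funext => h; rewrite rsumZ.
Qed.

(** * Averaging operators of commuting actions *)

Section Avg.
Context {X : Type}.
Implicit Types (act a b : G -> X -> X) (f : X -> R).

(** The Markov operator of the random walk that moves through [act] with step law [nu]. *)
Definition avg act f : X -> R := fun x => mean (fun g => f (act g x)).

Lemma avgN act f : avg act (fun x => - f x) = fun x => - avg act f x.
Proof. by apply/funext => x; rewrite /avg meanN. Qed.

Lemma avgB act f g : bnd f -> bnd g ->
  avg act (fun x => f x - g x) = fun x => avg act f x - avg act g x.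
Proof. by move=> bf bg; apply/funext => x; rewrite /avg meanB//; exact: bnd_comp. Qed.

Lemma avg_norm_le act f M : (forall x, `|f x| <= M) -> forall x, `|avg act f x| <= M.
Proof. by move=> h x; exact: mean_norm_le. Qed.

Lemma bnd_avg act f : bnd f -> bnd (avg act f).
Proof. by move=> [M /(avg_norm_le act)]; exists M. Qed.

Lemma avgC a b f : (forall g h x, a g (b h x) = b h (a g x)) -> bnd f ->
  avg a (avg b f) = avg b (avg a f).
Proof.
move=> ab [M hM]; apply/funext => x; rewrite /avg mean_swap; last by exists M.
by congr rsum; apply/funext => g; congr (_ * rsum _); apply/funext => h; rewrite ab.
Qed.

Lemma iter_avg_norm_le act f M j : (forall x, `|f x| <= M) ->
  forall x, `|iter j (avg act) f x| <= M.
Proof. by move=> h; elim: j => //= j IH; exact: avg_norm_le. Qed.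

Lemma avg_sub_le0 a b f : 0 < nu 1%g -> (forall x, a 1%g x = x) ->
  (forall g h x, a g (b h x) = b h (a g x)) -> bnd f -> avg a (avg b f) = f ->
  forall x, avg a f x - f x <= 0.
Proof.
move=> nu1 a1 ab [M hM] PQf.
pose F j := iter j (avg b) f; pose D j x := avg a (F j) x - F j x.
have FM j x : `|F j x| <= M by exact: iter_avg_norm_le.
have bF j : bnd (F j) by exists M.
(* [P] undoes one application of [Q]; hence [D j.+1 = F j - F j.+1], which telescopes. *)
have PF j : avg a (F j.+1) = F j.
  elim: j => [//|j IH]; rewrite /F iterS -/(F j.+1).
  by rewrite avgC// IH.
have bD j : bnd (D j) by apply: bndB => //; exact: bnd_avg.
have PD j : avg a (D j.+1) = D j.
  by rewrite /D avgB// ?PF//; exact: bnd_avg.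
have QD j : avg b (D j) = D j.+1.
  rewrite /D avgB//; last exact: bnd_avg.
  by rewrite -avgC//.
have DE j y : D j.+1 y = F j y - F j.+1 y by rewrite /D PF.
have Dsum n x : \sum_(j < n) D j.+1 x = f x - F n x.
  elim: n => [|n IH]; first by rewrite big_ord0 subrr.
  by rewrite big_ord_recr /= IH DE addrA subrK.
move=> x; rewrite leNgt; apply/negP => Dx.
pose S := [set D 0%N y | y in [set: X]]%classic.
have supS : has_sup S.
  split; first by exists (D 0%N x), x.
  by have [N hN] := bD 0%N; exists N => _ [y _ <-]; exact: le_trans (ler_norm _) (hN y).
set d := sup S.
have D0d y : D 0%N y <= d by apply: ub_le_sup; [case: supS|exists y].
have d0 : 0 < d by exact: lt_le_trans Dx (D0d x).
(* Each [D j.+1] is an average of values of [D j], so the supremum of [D 0] bounds them all. *)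
have Dd j y : D j y <= d.
  by elim: j y => // j IH y; rewrite -QD mean_le//; exact: bnd_comp.
have nu1le : nu 1%g <= 1.
  by rewrite -rsum_prob; apply: rsum_ge_term => //; exact: summ_prob.
have M0 : 0 <= M by exact: le_trans (hM x).
set al := nu 1%g in nu1 nu1le.
(* Chosen so that [n * (d / 2) > 2 * M], while the telescoped sum [f - F n] never exceeds
   [2 * M]. *)
pose n := Num.bound (4 * M / d).
have nM : 4 * M < n%:R * d.
  by rewrite -ltr_pdivrMr// archi_boundP// divr_ge0 ?mulr_ge0// ltW.
have eps0 : 0 < al ^+ n * (d / 2) by rewrite mulr_gt0 ?exprn_gt0// divr_gt0.
have [_ [z _ <-] hz] := sup_adherent eps0 supS.
(* [d - D j z] is the mean of the nonnegative [d - D j.+1 (a g z)]; only the term [g = 1] is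
   kept. *)
have step j : al * (d - D j.+1 z) <= d - D j z.
  rewrite -[D j]PD /avg -[X in _ <= X - _]mean_cst -meanB; [|exact: bnd_cst|exact: bnd_comp].
  rewrite -[in D j.+1 z](a1 z).
  apply: (mean_ge_term (fun g => d - D j.+1 (a g z))) => [|g]; last by rewrite subr_ge0.
  by apply: bndB; [exact: bnd_cst|exact: bnd_comp].
have zd : d - D 0%N z <= al ^+ n * (d / 2).
  by rewrite lerBlDl -lerBlDr; exact: ltW.
have := slow_decay_sum _ _ n _ nu1 nu1le (ltW d0) zd (fun j => Dd j z) step.
rewrite Dsum; move: (FM n z) (hM z); rewrite !ler_norml => /andP[+ _] /andP[_].
move: nM; clear; move: (F n z) (f z) (n%:R) (d) => y y' N e; clear.
by lra.
Qed.

Lemma avg_fixed a b f : 0 < nu 1%g -> (forall x, a 1%g x = x) ->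
  (forall g h x, a g (b h x) = b h (a g x)) -> bnd f -> avg a (avg b f) = f ->
  avg a f = f /\ avg b f = f.
Proof.
move=> nu1 a1 ab bf PQf; have Pf : avg a f = f.
  apply/funext => x; apply/eqP; rewrite eq_le -subr_le0 (avg_sub_le0 a b)//=.
  have /(_ x) : forall x, avg a (fun x => - f x) x - (- f x) <= 0.
    by apply: (avg_sub_le0 a b) => //; [exact: bndN|rewrite !avgN PQf].
  by rewrite avgN; lra.
(* [Q f = Q (P f) = P (Q f) = f]. *)
by split=> //; rewrite -[in LHS]Pf -avgC.
Qed.

End Avg.
End Mean.

(** * Biharmonic functions *)

(** A positive increment [a] would persist, forcing growth at least [n * a] after [n] steps, against
    the diameter [2 * K]. *)
Lemma bounded_incr_le0 {R : realType} (G : nat -> R) K : (forall k, `|G k| <= K) ->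
  (forall k, G k.+1 - G k <= G k.+2 - G k.+1) -> forall k, G k.+1 - G k <= 0.
Proof.
move=> GK inc k; rewrite leNgt; apply/negP; set a := G k.+1 - G k => a0.
have ak n : a <= G (k + n).+1 - G (k + n)%N.
  elim: n => [|n IH]; first by rewrite addn0.
  by rewrite addnS; exact: le_trans IH (inc _).
have low n : n%:R * a <= G (k + n)%N - G k.
  elim: n => [|n IH]; first by rewrite addn0 subrr mul0r.
  by rewrite addnS -natr1; move: (ak n) IH; lra.
have K0 : 0 <= K by exact: le_trans (GK 0%N).
have nK : 2 * K < (Num.bound (2 * K / a))%:R * a.
  by rewrite -ltr_pdivrMr// archi_boundP// divr_ge0 ?mulr_ge0// ltW.
move: (Num.bound _) nK => n nK; move: (low n) (GK (k + n)%N) (GK k).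
by rewrite !ler_norml => + /andP[_ +] /andP[+ _]; move: nK; clear; lra.
Qed.

Section Groups.
Context {R : realType} {G : groupType} (nu : G -> R).
Hypothesis nuP : prob_measure nu.

Let nu0 g : 0 <= nu g. Proof. by case: nuP. Qed.

Definition trl (g x : G) : G := (g * x)%g.
Definition trr (g x : G) : G := (x * g)%g.
Definition diag (e : G -> G -> G) (g : G) (p : G * G) : G * G := (e g p.1, e g p.2).

Lemma trrl g h x : trr g (trl h x) = trl h (trr g x).
Proof. by rewrite /trr /trl mulgA. Qed.

Lemma trl_bij g : bijective (trl g).
Proof. by exists (trl g^-1) => x; rewrite /trl ?mulKg ?mulVKg. Qed.

Lemma trr_bij g : bijective (trr g).
Proof. by exists (trr g^-1) => x; rewrite /trr ?mulgK ?mulgVK. Qed.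

Local Notation P := (avg nu trr).
Local Notation Q := (avg nu trl).

(** Both sides integrate [F] against the [k]-fold convolution power of [nu]. One step is
    [g * 1 = 1 * g]; commuting [Q] past the powers of [P] gives the rest. *)
Lemma iter_avg_unit k (F : G -> R) : bnd F -> iter k Q F 1%g = iter k P F 1%g.
Proof.
elim: k F => // k IH F bF; rewrite iterSr IH; last exact: bnd_avg.
have -> : iter k P (Q F) = Q (iter k P F).
  elim: k {IH} => //= k ->; rewrite avgC//; first exact: trrl.
  by case: bF => M hM; exists M; exact: iter_avg_norm_le.
by rewrite /= /avg; congr mean; apply/funext => g; rewrite /trl /trr mulg1 mul1g.
Qed.

(** * Vanishing of a nonnegative subharmonic defect *)

Section Subharmonic.
Variables (F u : G -> R) (K : R).
Hypotheses (FK : forall x, `|F x| <= K) (u0 : forall x, 0 <= u x)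
  (uE : forall x, u x = P F x - F x) (uQ : forall x, u x <= Q u x).

Let bF : bnd F. Proof. by exists K. Qed.

Let bu : bnd u.
Proof. by rewrite (funext uE); apply: bndB => //; exact: bnd_avg. Qed.

Let bQu k : bnd (iter k Q u).
Proof. by have [M hM] := bu; exists M; exact: iter_avg_norm_le. Qed.

Let Qu0 k x : 0 <= iter k Q u x.
Proof. by elim: k x => //= k IH x; apply: mean_ge0. Qed.

Lemma iter_avg_defect_unit k : iter k Q u 1%g = 0.
Proof.
have E j : iter j Q u 1%g = iter j.+1 P F 1%g - iter j P F 1%g.
  rewrite -[iter j P F _]iter_avg_unit// iterSr -iter_avg_unit; last exact: bnd_avg.
  have bi (f : G -> R) i : bnd f -> bnd (iter i Q f).
    by move=> [M hM]; exists M; exact: iter_avg_norm_le.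
  suff -> : iter j Q u = fun x => iter j Q (P F) x - iter j Q F x by [].
  elim: j => [|j IH]; first exact/funext.
  by rewrite iterS IH avgB//; apply: bi => //; exact: bnd_avg.
apply/eqP; rewrite eq_le Qu0 andbT E.
apply: (@bounded_incr_le0 _ (fun k => iter k P F 1%g) K) => j.
  exact: iter_avg_norm_le.
(* The increments are the values [Q^j u (1)], monotone in [j] because [Q] preserves [u <= Q u]. *)
rewrite -!E; elim: j 1%g => [|j IH] x //=.
by apply: ler_mean => [//|||g]; [exact: bnd_comp (bQu j)|exact: bnd_comp (bQu j.+1)|exact: IH].
Qed.

Lemma defect_eq0 : symmetric_measure nu -> generating_measure nu -> forall x, u x = 0.
Proof.
(* All iterates are recorded at once, since vanishing of the [k]-th one at [g * x] is drawn from
   that of the [k.+1]-st at [x]. *)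
move=> sy ge; pose Z x := forall k, iter k Q u x = 0.
have Zstep g x : nu g != 0 -> Z x -> Z (g * x)%g.
  move=> ng Zx k; have := Zx k.+1; rewrite /= /avg => m0.
  have : nu g * iter k Q u (trl g x) <= 0.
    rewrite -[X in _ <= X]m0; apply: (mean_ge_term _ nuP (fun g => iter k Q u (trl g x))) => [|y].
      exact: bnd_comp (bQu k).
    exact: Qu0.
  have ng0 : 0 < nu g by rewrite lt_def ng nu0.
  by rewrite pmulr_rle0// => h; apply: le_anti; rewrite h Qu0.
(* The elements that preserve [Z] together with their inverses form a subgroup; by symmetry of [nu]
   it contains the support. *)
suff SG g : forall x, Z x -> Z (g * x)%g /\ Z (g^-1 * x)%g.
  by move=> x; have [/(_ 0%N)] := SG x 1%g iter_avg_defect_unit; rewrite mulg1.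
apply: (ge (fun g => forall x, Z x -> Z (g * x)%g /\ Z (g^-1 * x)%g)).
- by move=> x; rewrite invg1 mul1g.
- move=> a b ha hb x Zx; split.
    by rewrite -mulgA; apply: (ha _ _).1; exact: (hb _ _).1.
  by rewrite invgM -mulgA; apply: (hb _ _).2; exact: (ha _ _).2.
- by move=> a ha x /ha[]; rewrite invgK.
- by move=> a na x Zx; split; apply: Zstep => //; rewrite -sy.
Qed.

End Subharmonic.

Definition colsum (f : G * G -> R) (x : G) : R := rsum (fun z => f (z, x)).

(** The diagonal map [e h] carries column [x] bijectively onto column [e h x], so column sums are
    merely translated; [rsum_mean] then exchanges sum and mean. *)
Lemma colsum_avg (e : G -> G -> G) (f : G * G -> R) K : (forall g, bijective (e g)) ->
  (forall p, 0 <= f p) -> (forall x, summ (fun z => f (z, x))) -> (forall x, colsum f x <= K) ->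
  (forall x, summ (fun z => avg nu (diag e) f (z, x))) /\
  colsum (avg nu (diag e) f) = avg nu e (colsum f).
Proof.
move=> be f0 sf fK.
have E h x : rsum (fun z => f (e h z, e h x)) = colsum f (e h x).
  exact: (rsum_reindex _ (fun z => f (z, e h x))).
have H x : summ (fun z => mean nu (fun h => f (e h z, e h x))) /\
    rsum (fun z => mean nu (fun h => f (e h z, e h x))) =
    mean nu (fun h => rsum (fun z => f (e h z, e h x))).
  apply: (rsum_mean nu nuP (fun h z => f (e h z, e h x)) K) => [//|h|h]; last by rewrite E.
  exact: (summ_reindex _ (fun z => f (z, e h x))).
split=> [x|]; first exact: (H x).1.
apply/funext => x; rewrite /colsum /avg (H x).2.
by congr mean; apply/funext => h; rewrite E.
Qed.

(** * Real kernels with uniformly square-summable columns *)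

Section RealOp.
Variables (t : G * G -> R) (K : R).
Hypotheses (tK : forall x (s : seq G), uniq s -> \sum_(z <- s) t (z, x) ^+ 2 <= K)
  (Pt : avg nu (diag trr) t = t) (Qt : avg nu (diag trl) t = t).

Let t2 p := t p ^+ 2.
Let t20 p : 0 <= t2 p. Proof. exact: sqr_ge0. Qed.

Lemma bnd_square_summable : bnd t.
Proof.
(* From [a <= 1 + a ^+ 2] with [a] the absolute value of one entry. *)
exists (1 + K) => -[z x]; have := tK x [:: z] isT; rewrite big_seq1 -real_normK ?num_real//.
by move: (normr_ge0 (t (z, x))) => /=; nra.
Qed.

Let bt := bnd_square_summable.

Let D h p := t (diag trr h p) - t p.
Let w p := mean nu (fun h => D h p ^+ 2).

Let bDp h : bnd (D h).
Proof. by apply: bndB => //; exact: bnd_comp. Qed.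

Let bD : bnd (fun q : G * (G * G) => D q.1 q.2 ^+ 2).
Proof. by apply: bnd_sqr; apply: bndB; exact: bnd_comp. Qed.

Let w0 p : 0 <= w p.
Proof. by apply: mean_ge0 => // h; exact: sqr_ge0. Qed.

Let wE p : w p = avg nu (diag trr) t2 p - t2 p.
Proof.
have b1 : bnd (fun h => t2 (diag trr h p)) by apply: bnd_comp; exact: bnd_sqr.
have b2 : bnd (fun h => t (diag trr h p)) by exact: bnd_comp.
have b3 : bnd (fun h => (2 * t p) * t (diag trr h p)) by apply: bndM => //; exact: bnd_cst.
have -> : w p = mean nu (fun h => (t2 (diag trr h p) - (2 * t p) * t (diag trr h p)) + t2 p).
  by congr mean; apply/funext => h; rewrite /D /t2; ring.
rewrite meanD//; [|exact: bndB|exact: bnd_cst].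
(* By [Pt] the cross term contributes [- 2 * t p ^+ 2]. *)
rewrite meanB// meanZ// mean_cst// -[mean nu (fun h => t _)]/(avg nu (diag trr) t p) Pt /avg /t2.
by ring.
Qed.

Let wQ p : w p <= avg nu (diag trl) w p.
Proof.
rewrite /avg /w mean_swap//; last by apply: (bnd_comp (fun q => (q.2, diag trl q.1 p)) _ bD).
apply: ler_mean => // [||h].
- by apply: (bnd_comp (fun h => (h, p)) _ bD).
- have [M hM] := bD; exists M => h; apply: mean_norm_le => // g.
  exact: (hM (h, diag trl g p)).
(* For fixed [h], [D h] is [Q]-harmonic because left and right translations commute; the variance
   inequality then applies to each [h]. *)
rewrite -[X in X ^+ 2](_ : mean nu (fun g => D h (diag trl g p)) = _).
  by apply: mean_sqr_le => //; exact: bnd_comp (bDp h).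
rewrite /D meanB//; [|exact: bnd_comp (fun g => diag trr h (diag trl g p)) _ bt|exact: bnd_comp].
rewrite -[X in _ - X]/(avg nu (diag trl) t p) Qt; congr (_ - _).
rewrite -[in RHS]Qt /avg; congr mean; apply/funext => g.
by rewrite /diag/= !trrl.
Qed.

Let ct2 x : summ (fun z => t2 (z, x)) /\ colsum t2 x <= K.
Proof. by apply: rsum_bound => [z|s us]; [exact: t20|exact: tK]. Qed.

Lemma biharmonic_right_invariant : symmetric_measure nu -> generating_measure nu ->
  forall h p, t (diag trr h p) = t p.
Proof.
move=> sy ge.
have st2 x := (ct2 x).1; have ct2K x := (ct2 x).2.
have [sP cP] := colsum_avg _ _ K trr_bij t20 st2 ct2K.
have c0 x : 0 <= colsum t2 x by apply: rsum_ge0 => z; exact: t20.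
have bc : bnd (colsum t2) by exists K => x; rewrite ger0_norm.
have sw x : summ (fun z => w (z, x)).
  by rewrite (_ : (fun z => _) = fun z => avg nu (diag trr) t2 (z, x) - t2 (z, x));
    [exact: summB|exact/funext].
have cw x : colsum w x = P (colsum t2) x - colsum t2 x.
  by rewrite -cP /colsum -rsumB//; congr rsum; apply/funext => z; exact: wE.
(* The uniform bound that lets [colsum_avg] be applied to [w]. *)
have cwK x : colsum w x <= K.
  rewrite cw (le_trans (y := P (colsum t2) x)) ?gerBl//.
  by apply: mean_le => //; exact: bnd_comp.
have [sQ cQ] := colsum_avg _ _ K trl_bij w0 sw cwK.
have cw0 := defect_eq0 (colsum t2) (colsum w) K _ _ cw _ sy ge.
have {}cw0 x : colsum w x = 0.
  apply: cw0 => {}x; first by rewrite ger0_norm.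
  - by apply: rsum_ge0 => z; exact: w0.
  - by rewrite -cQ; apply: ler_rsum => // z; exact: wQ.
have wz p : w p = 0.
  apply: le_anti; rewrite w0 andbT; case: p => z x; rewrite -(cw0 x).
  exact: (rsum_ge_term (fun z => w (z, x))).
(* The [h] whose right translation fixes [t] form a subgroup; on the support of [nu], [w p = 0]
   forces [D h p = 0]. *)
apply: ge => [p|a b ha hb p|a ha p|h nh p].
- by case: p => z x; rewrite /diag /trr /= !mulg1.
- by rewrite -(ha p) -(hb (diag trr a p)) /diag /trr /= !mulgA.
- by rewrite -(ha (diag trr a^-1%g p)); case: p => z x; rewrite /diag /trr /= !mulgVK.
- have nh0 : 0 < nu h by rewrite lt_def nh nu0.
  have : nu h * D h p ^+ 2 <= 0.
    rewrite -(wz p); apply: (mean_ge_term _ _ (fun h => D h p ^+ 2)) => // [|g].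
      by apply: (bnd_comp (fun h => (h, p)) _ bD).
    exact: sqr_ge0.
  rewrite pmulr_rle0// => h0; apply/eqP; rewrite -subr_eq0 -/(D h p) -sqrf_eq0.
  by apply/eqP/le_anti; rewrite h0 sqr_ge0.
Qed.

End RealOp.

Lemma biharmonic_invariant (t : G * G -> R) K :
  (forall x (s : seq G), uniq s -> \sum_(z <- s) t (z, x) ^+ 2 <= K) ->
  avg nu (diag trr) t = t -> avg nu (diag trl) t = t ->
  symmetric_measure nu -> generating_measure nu ->
  (forall h x y, t ((x * h)%g, (y * h)%g) = t (x, y)) /\
  (forall h x y, t ((h * x)%g, (h * y)%g) = t (x, y)).
Proof.
move=> tK Pt Qt sy ge; split=> h x y.
  exact: (biharmonic_right_invariant t K tK Pt Qt sy ge h (x, y)).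
pose t' (p : G * G) := t (p.1^-1, p.2^-1)%g.
have inv_bij : bijective (@monoid.inv G) by exists monoid.inv; exact: invgK.
(* Inversion turns right translation by [g] into left translation by [g^-1]; symmetry of [nu]
   absorbs this inverse in the mean. *)
have mean_inv (f : G -> R) : mean nu (fun g => f g^-1%g) = mean nu f.
  rewrite /mean -(rsum_reindex _ _ inv_bij); congr rsum; apply/funext => g.
  by rewrite invgK -sy.
have tK' v (s : seq G) : uniq s -> \sum_(z <- s) t' (z, v) ^+ 2 <= K.
  move=> us; rewrite /t' /= -(big_map monoid.inv xpredT (fun z => t (z, v^-1)%g ^+ 2)).
  by apply: tK; rewrite map_inj_uniq//; exact: invg_inj.
have Pt' : avg nu (diag trr) t' = t'.
  apply/funext => -[z u]; rewrite /t' -[in RHS]Qt /avg -[RHS]mean_inv; congr mean.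
  by apply/funext => g; rewrite /diag /trr /trl /= !invgM.
have Qt' : avg nu (diag trl) t' = t'.
  apply/funext => -[z u]; rewrite /t' -[in RHS]Pt /avg -[RHS]mean_inv; congr mean.
  by apply/funext => g; rewrite /diag /trr /trl /= !invgM.
have := biharmonic_right_invariant t' K tK' Pt' Qt' sy ge h^-1%g (x^-1, y^-1)%g.
by rewrite /t' /diag /trr /= !invgM !invgK.
Qed.

End Groups.

(** * Operators *)

Section Operators.
Context {R : realType} {G : groupType}.
Implicit Types (T S : op R G).

Lemma sqr_cnorm (z : R[i]) : cnorm z ^+ 2 = complex.Re z ^+ 2 + complex.Im z ^+ 2.
Proof. by rewrite sqr_sqrtr// addr_ge0 ?sqr_ge0. Qed.

Lemma conjc_mul_self (z : R[i]) : conjc z * z = ((cnorm z ^+ 2)%:C)%C.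
Proof.
rewrite sqr_cnorm; case: z => a b; apply/eqP; rewrite eq_complex /=.
by apply/andP; split; apply/eqP; ring.
Qed.

(** Testing the form on the truncated column [u = T delta_y] and [v = delta_y] gives
    [A <= C * sqrt A] for the partial sum [A], hence [A <= C ^+ 2]. *)
Lemma bounded_op_column T : bounded_op T -> exists K, forall y (s : seq G), uniq s ->
  \sum_(x <- s) cnorm (T x y) ^+ 2 <= K.
Proof.
move=> [C hC]; exists (C ^+ 2) => y s us.
(* The form runs both variables over the same list, so [y] must belong to it; adding [y] only
   enlarges the sum. *)
wlog ys : s us / y \in s => [H|].
  have [/H->//|ys] := boolP (y \in s).
  apply: le_trans (H (y :: s) _ _); rewrite /= ?ys ?mem_head//.
  by rewrite big_cons lerDr sqr_ge0.
have := hC s us (fun x => T x y) (fun z => if z == y then 1 else 0).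
under eq_bigr => x _.
  rewrite (bigD1_seq y)//= eqxx mulr1 conjc_mul_self big1 ?addr0; last first.
    by move=> z /negbTE ->; rewrite mulr0.
  over.
have -> : \sum_(z <- s) cnorm (if z == y then 1 else 0 : R[i]) ^+ 2 = 1.
  rewrite (bigD1_seq y)//= eqxx big1 => [|z /negbTE ->]; rewrite sqr_cnorm /=; by ring.
rewrite sqrtr1 mulr1 -(rmorph_sum (real_complex R)) /=.
set A := \sum_(x <- s) _; have A0 : 0 <= A by apply: sumr_ge0 => x _; exact: sqr_ge0.
rewrite /cnorm /= expr0n addr0 sqrtr_sqr ger0_norm//.
move: (sqr_sqrtr A0) (sqrtr_ge0 A); move: (Num.sqrt A) => r <- r0; clear => h.
case: (eqVneq r 0) h => [-> _|rn h]; first by rewrite expr0n sqr_ge0.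
by nra.
Qed.

Definition re T (p : G * G) : R := complex.Re (T p.1 p.2).
Definition im T (p : G * G) : R := complex.Im (T p.1 p.2).

Lemma op_eq S T : re S = re T -> im S = im T -> S = T.
Proof.
move=> /funeqP er /funeqP ei; apply/funext => x; apply/funext => y.
by apply/eqP; rewrite eq_complex; apply/andP; split; apply/eqP; [exact: (er (x, y))|exact: (ei (x, y))].
Qed.

Lemma ReM_real (a : R) (z : R[i]) : complex.Re ((a%:C)%C * z) = a * complex.Re z.
Proof. by case: z => x y /=; rewrite mul0r subr0. Qed.

Lemma ImM_real (a : R) (z : R[i]) : complex.Im ((a%:C)%C * z) = a * complex.Im z.
Proof. by case: z => x y /=; rewrite mul0r addr0. Qed.

Lemma re_Pnu nu T : re (Pnu nu T) = avg nu (diag trr) (re T).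
Proof.
by apply/funext => p; rewrite /avg /mean /re /=; congr rsum; apply/funext => g; rewrite ReM_real.
Qed.

Lemma im_Pnu nu T : im (Pnu nu T) = avg nu (diag trr) (im T).
Proof.
by apply/funext => p; rewrite /avg /mean /im /=; congr rsum; apply/funext => g; rewrite ImM_real.
Qed.

Lemma re_Pnu_o nu T : re (Pnu_o nu T) = avg nu (diag trl) (re T).
Proof.
by apply/funext => p; rewrite /avg /mean /re /=; congr rsum; apply/funext => g; rewrite ReM_real.
Qed.

Lemma im_Pnu_o nu T : im (Pnu_o nu T) = avg nu (diag trl) (im T).
Proof.
by apply/funext => p; rewrite /avg /mean /im /=; congr rsum; apply/funext => g; rewrite ImM_real.
Qed.

Lemma nnsum_single (f : G -> R) a : 0 <= f a -> (forall x, x != a -> f x = 0) -> nnsum f = f a.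
Proof.
move=> f0 h; rewrite /nnsum -[RHS]/(fine (f a)%:E) -(@esum_set1 _ _ a (fun x => (f x)%:E)) ?lee_fin//.
rewrite [in RHS]esum_mkcond; congr fine; apply: eq_esum => x _.
by case: ifPn => // xa; rewrite h//; apply: contraNneq xa => ->; exact: mem_set.
Qed.

Lemma rsum_single (f : G -> R) a : (forall x, x != a -> f x = 0) -> rsum f = f a.
Proof.
move=> h; rewrite rsumE !(nnsum_single _ a) ?pos_ge0 ?neg_ge0 -?pos_sub_neg// => x /h xa.
  by rewrite /neg xa oppr0 maxxx.
by rewrite /pos xa maxxx.
Qed.

Lemma csum_single (f : G -> R[i]) a : (forall x, x != a -> f x = 0) -> csum f = f a.
Proof.
move=> h; rewrite /csum !(rsum_single _ a) => [|x /h->//|x /h->//].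
by case: (f a).
Qed.

Lemma csum_reindex (e : G -> G) (f : G -> R[i]) : bijective e -> csum (fun x => f (e x)) = csum f.
Proof.
by move=> be; rewrite /csum; congr Complex; exact: (rsum_reindex e _ be).
Qed.

Lemma lambda_mul g S x y : op_mul (lambda R g) S x y = S (g^-1 * x)%g y.
Proof.
rewrite /op_mul (csum_single _ (g^-1 * x)%g) /lambda ?mulVKg ?eqxx ?mul1r// => z.
by rewrite eq_sym -(inj_eq (mulgI g)) mulVKg => /negbTE ->; rewrite mul0r.
Qed.

Lemma mul_lambda g S x y : op_mul S (lambda R g) x y = S x (g * y)%g.
Proof.
rewrite /op_mul (csum_single _ (g * y)%g) /lambda ?eqxx ?mulr1// => z.
by move/negbTE => ->; rewrite mulr0.
Qed.

Lemma invariant_center T : bounded_op T ->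
  (forall h x y, T (x * h)%g (y * h)%g = T x y) ->
  (forall h x y, T (h * x)%g (h * y)%g = T x y) -> center_groupvN T.
Proof.
move=> bT rT lT.
have cT : commutant (fun S => exists g, S = lambda R g) T.
  split=> // _ [g ->]; apply/funext => x; apply/funext => y.
  by rewrite lambda_mul mul_lambda -(lT g) mulVKg.
(* Elements of [L(G)] commute with the commutant of the [lambda g], to which [T] belongs by [cT]. *)
split; last by move=> S [_ /(_ _ cT)].
split=> // S [_ cS].
have lS h x y : S (h * x)%g (h * y)%g = S x y.
  have := cS _ (ex_intro _ h erefl) => /funeqP /(_ (h * x)%g) /funeqP /(_ y).
  by rewrite lambda_mul mul_lambda mulKg.
apply/funext => x; apply/funext => y.
have be : bijective (fun z : G => y * z^-1 * x)%g.
  exists (fun w => x * w^-1 * y)%g => z; rewrite !invgM invgK !mulgA.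
    by rewrite mulgV mul1g mulgVK.
  by rewrite mulgV mul1g mulgVK.
(* After the substitution in [T S], right invariance gives [T x (y z^-1 x) = T z y] and left
   invariance gives [S (y z^-1 x) y = S x z]. *)
rewrite /op_mul -[in RHS](csum_reindex _ _ be); congr csum; apply/funext => z.
rewrite mulrC; congr (_ * _).
  by rewrite -(rT x^-1 x)%g mulgV mulgK -(rT z 1)%g mul1g mulgVK.
by rewrite -[RHS](lS (z * y^-1)%g) !mulgA !mulgVK mulgV mul1g.
Qed.

End Operators.

Theorem theorem3p2 (R : realType) (G : groupType) (nu : G -> R) (T : op R G) :
  countable_group G ->
  prob_measure nu ->
  0 < nu 1%g ->
  bounded_op T ->
  Pnu nu (Pnu_o nu T) = T ->
  (Pnu nu T = T /\ Pnu_o nu T = T) /\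
  (symmetric_measure nu -> generating_measure nu -> center_groupvN T).
Proof.
move=> _ nuP nu1 bT PQT.
have [K hK] := bounded_op_column T bT.
have reK y (s : seq G) : uniq s -> \sum_(x <- s) re T (x, y) ^+ 2 <= K.
  move=> us; apply: le_trans (hK y s us); apply: ler_sum => x _.
  by rewrite sqr_cnorm lerDl sqr_ge0.
have imK y (s : seq G) : uniq s -> \sum_(x <- s) im T (x, y) ^+ 2 <= K.
  move=> us; apply: le_trans (hK y s us); apply: ler_sum => x _.
  by rewrite sqr_cnorm lerDr sqr_ge0.
have act1 (p : G * G) : diag trr 1%g p = p by case: p => x y; rewrite /diag /trr /= !mulg1.
have actC g h (p : G * G) : diag trr g (diag trl h p) = diag trl h (diag trr g p).
  by rewrite /diag /= !trrl.
have [reP reQ] : avg nu (diag trr) (re T) = re T /\ avg nu (diag trl) (re T) = re T.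
  apply: (avg_fixed nu nuP _ _ _ nu1 act1 actC); first exact: bnd_square_summable reK.
  by rewrite -re_Pnu_o -re_Pnu PQT.
have [imP imQ] : avg nu (diag trr) (im T) = im T /\ avg nu (diag trl) (im T) = im T.
  apply: (avg_fixed nu nuP _ _ _ nu1 act1 actC); first exact: bnd_square_summable imK.
  by rewrite -im_Pnu_o -im_Pnu PQT.
split; first by split; apply: op_eq; rewrite ?re_Pnu ?im_Pnu ?re_Pnu_o ?im_Pnu_o.
move=> sy ge.
have [rer rel] := biharmonic_invariant nu nuP (re T) K reK reP reQ sy ge.
have [imr iml] := biharmonic_invariant nu nuP (im T) K imK imP imQ sy ge.
apply: invariant_center => // h x y; apply/eqP; rewrite eq_complex; apply/andP; split; apply/eqP.
- exact: rer.
- exact: imr.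
- exact: rel.
- exact: iml.
Qed.
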